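(* Let $\alpha\geq1$ (with $\alpha$ rational in the case of $\mathcal K_\alpha^\mu$), and let $(\mathcal K,\sqsubseteq)$ be one of $(\mathcal K_\alpha^+,\leqslant_\alpha)$, $(\mathcal K_\alpha^\mu,\leqslant_\alpha)$, $(\mathcal K_\alpha^{\mathsf f},<_\alpha)$ (for $\mathsf f$ good). Then $(\mathcal K,\sqsubseteq)$ does not have the one-point $\sqsubseteq$-Ramsey property.
   Context: $\mathfrak L=\{\mathfrak R\}$ with $\mathfrak R$ binary; structures are finite graphs. For a finite graph $A$, $\delta_\alpha(A)=\alpha|V(A)|-|E(A)|$ and $\delta_\alpha(C/A)=\delta_\alpha(C)-\delta_\alpha(A)$. For graphs $A\subseteq B$, $A\leqslant_\alpha B$ iff $\delta_\alpha(C/A)\geq0$ for all $C$ with $A\subseteq C\subseteq B$; $A<_\alpha B$ iff $\delta_\alpha(A)<\delta_\alpha(B')$ for every $B'$ with $A\subsetneq B'\subseteq B$. $\mathcal K_\alpha^+$ is the class of finite graphs $A$ with $\delta_\alpha(B)\geq0$ for all $B\subseteq A$. For rational $\alpha$: for disjoint finite $A,B$ (in a graph in $\mathcal K^+_\alpha$), $B$ is $0$-algebraic over $A$ if $\delta_\alpha(B/A)=0$ and $\delta_\alpha(B_0/A)>0$ for all $\emptyset\neq B_0\subsetneq B$ (here $\delta_\alpha(B/A)=\delta_\alpha(A\cup B)-\delta_\alpha(A)$); $B$ is $0$-minimally algebraic over $A$ if moreover there is no proper subset $A_0\subsetneq A$ over which $B$ is $0$-algebraic. Let $\mathcal E$ be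 the set of (isomorphism types of) pairs $(A,B)$ with $A\neq\emptyset$ and $B$ $0$-minimally algebraic over $A$, and $\mu:\mathcal E\to\mathbb N$ finite-to-one with $\mu(A,B)\geq\delta_\alpha(A)$. $\mathcal K_\alpha^\mu$ is the class of $A\in\mathcal K_\alpha^+$ such that for all $A'\subseteq A$ and $B'$ $0$-minimally algebraic over $A'$, the number of pairwise disjoint isomorphic copies of $B'$ over $A'$ in $A$ is at most $\mu(A',B')$. For an increasing unbounded $\mathsf f:\mathbb R^{\geq0}\to\mathbb R^{\geq0}$, $\mathcal K_\alpha^{\mathsf f}=\{A\in\mathcal K_\alpha^+:\delta_\alpha(A')\geq\mathsf f(|A'|)\ \forall A'\subseteq A\}$; $\mathsf f$ is called good when $(\mathcal K_\alpha^{\mathsf f},<_\alpha)$ is a smooth class with the free-amalgamation property and the hereditary property. For $A\sqsubseteq B\sqsubseteq C$ in $\mathcal K$, let $\binom{C}{A}$ denote the set of embeddings $\gamma$ of $A$ into $C$ with $\gamma[A]\sqsubseteq C$, and write $C\to(B)^A_k$ if for every map $c:\binom{C}{A}\to\{0,\dots,k-1\}$ there is $\lambda\in\binom{C}{B}$ with $c(\lambda\circ\gamma)$ the same for all $\gamma\in\binom{B}{A}$. $(\mathcal K,\sqsubseteq)$ has the one-point $\sqsubseteq$-Ramsey property if for every one-point structure $A\in\mathcal K$, every $B\in\mathcal K$ with $A\sqsubseteq B$ and every $k\geq2$ there is $C\in\mathcal K$ with $B\sqsubseteq C$ and $C\to(B)^A_k$.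
   Formalization: In the K_α^f case it is additionally assumed that α>1 and that some graph in K_α^f has an edge; otherwise the claim fails (e.g. f(x)=αx gives only edgeless graphs, and for α=1 strong points are isolated, so one-point Ramsey holds by pigeonhole). *)

(* Defs.v *)
From HB Require Import structures.
From mathcomp Require Import all_boot all_order all_algebra.
From mathcomp Require Import reals.

Set Implicit Arguments.
Unset Strict Implicit.
Unset Printing Implicit Defensive.

Import Order.TTheory GRing.Theory Num.Theory.
Local Open Scope ring_scope.

(* Substructures of a graph [G] are given by their vertex sets [S : {set G}],
   standing for the induced subgraph on [S]. *)

Record graph := Graph {
  vertex :> finType;
  adj : rel vertex;
  adj_sym : symmetric adj;
  adj_irr : irreflexive adj
}.

Section Induced.
Variables (G : graph) (S : {set G}).

Definition induced_adj : rel {x : G | x \in S} :=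
  fun x y => adj (val x) (val y).

Lemma induced_adj_sym : symmetric induced_adj.
Proof. by move=> x y; apply: adj_sym. Qed.

Lemma induced_adj_irr : irreflexive induced_adj.
Proof. by move=> x; apply: adj_irr. Qed.

Definition induced : graph := Graph induced_adj_sym induced_adj_irr.

(* The vertex set [T], cut down to [S] and seen inside the induced subgraph. *)
Definition restrict (T : {set G}) : {set induced} :=
  [set x : induced | val x \in T].
End Induced.

Definition edges (G : graph) (S : {set G}) : {set {set G}} :=
  [set e : {set G} | (e \subset S)
     && [exists x : G, exists y : G, adj x y && (e == [set x; y])]].

Definition embedding (A B : graph) (e : A -> B) : Prop :=
  injective e /\ forall x y, adj (e x) (e y) = adj x y.

Definition isomorphism (A B : graph) (e : A -> B) : Prop :=
  bijective e /\ forall x y, adj (e x) (e y) = adj x y.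

Section Predimension.
Variables (R : realType) (alpha : R).

Definition delta (G : graph) (S : {set G}) : R :=
  alpha * #|S|%:R - #|edges S|%:R.

(* [delta_over C A] is $\delta_\alpha(C/A)$ for $A \subseteq C$. *)
Definition delta_over (G : graph) (C A : {set G}) : R := delta C - delta A.

Definition le_alpha (B : graph) (A : {set B}) : Prop :=
  forall C : {set B}, A \subset C -> 0 <= delta_over C A.

Definition lt_alpha (B : graph) (A : {set B}) : Prop :=
  forall B' : {set B}, A \proper B' -> delta A < delta B'.

Definition Kplus (G : graph) : Prop := forall S : {set G}, 0 <= delta S.

Definition zero_algebraic (G : graph) (A B : {set G}) : Prop :=
  [/\ [disjoint A & B],
      delta_over (A :|: B) A = 0
    & forall B0 : {set G}, B0 != set0 -> B0 \proper B ->
        0 < delta_over (A :|: B0) A].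

Definition zero_min_algebraic (G : graph) (A B : {set G}) : Prop :=
  zero_algebraic A B /\
  forall A0 : {set G}, A0 \proper A -> ~ zero_algebraic A0 B.

(* A pair $(A, B)$ of disjoint sets, presented as the graph on $A \cup B$
   together with $A$; thus $B$ is the complement of [pbase]. *)
Record gpair := GPair { pgraph : graph; pbase : {set pgraph} }.

Definition gpair_iso (P Q : gpair) : Prop :=
  exists2 e : pgraph P -> pgraph Q,
    isomorphism e & [set e x | x in pbase P] = pbase Q.

Definition pair_of (G : graph) (A B : {set G}) : gpair :=
  GPair (restrict (A :|: B) A).

Definition calE (P : gpair) : Prop :=
  [/\ Kplus (pgraph P), pbase P != set0
    & zero_min_algebraic (pbase P) (~: pbase P)].

(* A function on the isomorphism types in $\mathcal E$ is an
   isomorphism-invariant function on [calE]; its values elsewhere are never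
   used. *)
Definition mu_function (mu : gpair -> nat) : Prop :=
  [/\ forall P Q, calE P -> calE Q -> gpair_iso P Q -> mu P = mu Q,
      forall n : nat, exists (m : nat) (Q : 'I_m -> gpair),
        forall P, calE P -> mu P = n -> exists i, gpair_iso P (Q i)
    & forall P, calE P -> delta (pbase P) <= (mu P)%:R].

Definition copy_over (G : graph) (A B B' : {set G}) : Prop :=
  [disjoint A & B'] /\
  exists e : induced (A :|: B) -> induced (A :|: B'),
    isomorphism e /\ forall x, val x \in A -> val (e x) = val x.

(* It is enough to let $B'$ range over the subsets of [G]: a structure over
   $A'$ with no copy in [G] imposes no condition, and otherwise it may be
   replaced by one of its copies. *)
Definition Kmu (mu : gpair -> nat) (G : graph) : Prop :=
  Kplus G /\
  forall A' B' : {set G}, A' != set0 -> zero_min_algebraic A' B' ->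
  forall F : {set {set G}}, trivIset F ->
    (forall X, X \in F -> copy_over A' B' X) ->
    (#|F| <= mu (pair_of A' B'))%N.

Definition Kf (f : R -> R) (G : graph) : Prop :=
  Kplus G /\ forall S : {set G}, f #|S|%:R <= delta S.

End Predimension.

(* [f] represents an increasing unbounded function
   $\mathbb R^{\geq 0} \to \mathbb R^{\geq 0}$; its values at negative reals
   are irrelevant. *)
Definition increasing_unbounded (R : realType) (f : R -> R) : Prop :=
  [/\ forall x, 0 <= x -> 0 <= f x,
      forall x y, 0 <= x -> x <= y -> f x <= f y
    & forall M, exists2 x, 0 <= x & M < f x].

(* For [sub : strong_rel], [sub G S] means that the subgraph of [G] induced on
   [S] is a $\sqsubseteq$-substructure of [G]. *)
Definition strong_rel := forall G : graph, {set G} -> Prop.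

(* Universal formulas of the language of graphs, with free variables indexed
   by [V] and [m] universally quantified variables, as in the definition of
   smooth classes by Kueker and Laskowski. *)
Inductive qf_formula (V : Type) :=
  | Feq of V & V
  | Fadj of V & V
  | Fnot of qf_formula V
  | Fand of qf_formula V & qf_formula V.

Fixpoint qf_holds (V : Type) (G : graph) (v : V -> G) (phi : qf_formula V)
    : bool :=
  match phi with
  | Feq x y => v x == v y
  | Fadj x y => adj (v x) (v y)
  | Fnot p => ~~ qf_holds v p
  | Fand p q => qf_holds v p && qf_holds v q
  end.

Record universal_formula (V : Type) := UFormula {
  uf_arity : nat;
  uf_matrix : qf_formula (V + 'I_uf_arity)
}.

Definition uf_holds (V : Type) (G : graph) (a : V -> G)
    (phi : universal_formula V) : Prop :=
  forall y : 'I_(uf_arity phi) -> G,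
    qf_holds (fun z => match z with inl i => a i | inr j => y j end)
             (uf_matrix phi).

Section Classes.
Variables (K : graph -> Prop) (sub : strong_rel).

Definition iso_closed : Prop :=
  forall (A B : graph) (e : A -> B), isomorphism e -> K A -> K B.

Definition strong_refl : Prop := forall G, K G -> sub [set: G].

Definition strong_trans : Prop :=
  forall (G : graph) (S T : {set G}), S \subset T ->
    K G -> K (induced T) -> K (induced S) ->
    sub (restrict T S) -> sub T -> sub S.

Definition universally_defined : Prop :=
  forall A : graph, K A ->
  exists Phi : universal_formula A -> Prop,
  forall (C : graph) (e : A -> C), K C -> embedding e ->
    sub [set e x | x : A] <-> (forall phi, Phi phi -> uf_holds e phi).

Definition smooth_class : Prop :=
  [/\ iso_closed, strong_refl, strong_trans & universally_defined].

Definition hereditary : Prop :=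
  forall (G : graph) (S : {set G}), K G -> K (induced S).

(* [G] is the free amalgam of its subgraphs on [S] and [T] over their
   intersection. *)
Definition free_amalgam (G : graph) (S T : {set G}) : Prop :=
  S :|: T = [set: G] /\
  forall x y, x \in S :\: T -> y \in T :\: S -> ~~ adj x y.

Definition free_amalgamation : Prop :=
  forall (G : graph) (S T : {set G}), free_amalgam S T ->
    K (induced S) -> K (induced T) -> K (induced (S :&: T)) ->
    sub (restrict S (S :&: T)) -> sub (restrict T (S :&: T)) ->
    [/\ K G, sub S & sub T].

(* Membership in $\binom{C}{A}$. *)
Definition strong_embedding (A C : graph) (g : {ffun A -> C}) : Prop :=
  embedding g /\ sub [set g x | x : A].

(* $A \sqsubseteq B$, with the inclusion replaced by an embedding. *)
Definition strong_sub (A B : graph) : Prop :=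
  exists g : {ffun A -> B}, strong_embedding g.

(* A colouring is a total function on maps [A -> C]; only its values on
   $\binom{C}{A}$ are used. *)
Definition arrow (C B A : graph) (k : nat) : Prop :=
  forall c : {ffun A -> C} -> 'I_k,
  exists2 l : {ffun B -> C}, strong_embedding l &
    forall g g' : {ffun A -> B}, strong_embedding g -> strong_embedding g' ->
      c [ffun x => l (g x)] = c [ffun x => l (g' x)].

Definition one_point_ramsey : Prop :=
  forall A : graph, K A -> #|A| = 1%N ->
  forall B : graph, K B -> strong_sub A B ->
  forall k : nat, (2 <= k)%N ->
  exists C : graph, [/\ K C, strong_sub B C & arrow C B A k].

End Classes.

Definition good (R : realType) (alpha : R) (f : R -> R) : Prop :=
  [/\ smooth_class (Kf alpha f) (@lt_alpha R alpha),
      free_amalgamation (Kf alpha f) (@lt_alpha R alpha)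
    & hereditary (Kf alpha f)].

(* Main.v *)
Require Import Defs.
From mathcomp Require Import all_boot all_order all_algebra.
From mathcomp Require Import reals.
Set Implicit Arguments.
Unset Strict Implicit.
Unset Printing Implicit Defensive.
Import Order.TTheory GRing.Theory Num.Theory.
Local Open Scope ring_scope.

(** Every subgraph of a graph in $\mathcal K_\alpha^+$ has at most $\alpha$
    times as many edges as vertices, hence a vertex of degree at most
    $2\alpha$; so all graphs of the class have proper colourings with one and
    the same number $k$ of colours. Take for $B$ a single edge, whose two
    endpoints are both strong because $\alpha \geq 1$: a proper $k$-colouring
    of $C$ never makes a copy of $B$ monochromatic. *)

(** * Edges and degrees *)

Lemma edgesP (G : graph) (S e : {set G}) :
  reflect (exists x y, [/\ x \in S, y \in S, adj x y & e = [set x; y]])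
          (e \in edges S).
Proof.
rewrite inE; apply: (iffP andP).
  case=> eS /existsP[x /existsP[y /andP[axy /eqP ee]]].
  exists x, y; split=> //; apply: (subsetP eS); rewrite ee !inE eqxx //.
  exact: orbT.
case=> x [y [xS yS axy ->]]; split.
  by apply/subsetP=> z; rewrite !inE => /orP[] /eqP->.
by apply/existsP; exists x; apply/existsP; exists y; rewrite axy eqxx.
Qed.

Lemma adj_neq (G : graph) (x y : G) : adj x y -> x != y.
Proof. by move=> axy; apply: contraTneq axy => ->; rewrite adj_irr. Qed.

Lemma card_edge (G : graph) (S e : {set G}) : e \in edges S -> #|e| = 2%N.
Proof.
by move=> /edgesP[x [y [_ _ /adj_neq nxy ->]]]; rewrite cards2 nxy.
Qed.

Lemma edge_sub (G : graph) (S e : {set G}) : e \in edges S -> e \subset S.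
Proof. by rewrite inE => /andP[]. Qed.

(** Double counting of the pairs of a vertex of [S] and an edge of [S] through it: sending [y] to
    [[set x; y]] injects the neighbours of [x] into the edges at [x], and each edge has two ends. *)
Lemma sum_degree_edges (G : graph) (S : {set G}) :
  (\sum_(x in S) #|[set y in S | adj x y]| <= 2 * #|edges S|)%N.
Proof.
apply: (@leq_trans (\sum_(x in S) \sum_(e in edges S) (x \in e))%N).
  apply: leq_sum => x xS.
  pose h (y : G) := [set x; y].
  have h_inj : {in [set y in S | adj x y] &, injective h}.
    move=> y z; rewrite !inE => /andP[_ /adj_neq nxy] /andP[_ _] hyz.
    have: y \in h z by rewrite -hyz !inE eqxx orbT.
    by rewrite !inE eq_sym (negPf nxy) => /eqP.
  rewrite -(card_in_imset h_inj) -big_mkcondr sum1dep_card; apply: subset_leq_card.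
  apply/subsetP=> _ /imsetP[y + ->]; rewrite inE => /andP[yS axy].
  rewrite inE; apply/andP; split; last by rewrite !inE eqxx.
  by apply/edgesP; exists x, y.
rewrite exchange_big /= mulnC -sum_nat_const; apply: leq_sum => e eS.
rewrite -(card_edge eS) -big_mkcondr sum1dep_card; apply: subset_leq_card.
by apply/subsetP=> x; rewrite !inE => /andP[].
Qed.

(** An edge has two elements, so it fills any [S] of size at most two, and no second edge fits. *)
Lemma card_edges_le2 (G : graph) (S : {set G}) :
  (#|G| <= 2)%N -> (#|edges S| <= (#|S| == 2%N))%N.
Proof.
move=> G2; have S2 : (#|S| <= 2)%N by apply: leq_trans G2; apply: max_card.
have edgeE e : e \in edges S -> e = S.
  move=> eS; apply/eqP.
  by rewrite eqEcard edge_sub //= (card_edge eS).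
case: (set_0Vmem (edges S)) => [->|[e eS]]; first by rewrite cards0.
have -> : edges S = [set S].
  apply/setP=> e'; rewrite [RHS]inE; apply/idP/eqP => [/edgeE//|->].
  by rewrite -{1}(edgeE e eS).
by rewrite cards1 -(card_edge eS) (edgeE e eS) eqxx.
Qed.

(** * Induced subgraphs, copies and disjoint families *)

(** Taking images under [val] matches the edges on both sides. With the vertex count below, this
    makes [delta] independent of the ambient graph. *)
Lemma edges_restrict (G : graph) (U S : {set G}) : S \subset U ->
  #|edges (restrict U S)| = #|edges S|.
Proof.
move=> SU; pose v (x : induced U) : G := val x.
have v_inj : injective v by exact: val_inj.
rewrite -(card_imset _ (imset_inj v_inj)); congr #|pred_of_set _|.
apply/setP=> e; apply/imsetP/edgesP => [[e' e'S ->]|].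
  case/edgesP: e'S => x [y [xS yS axy ->]]; exists (v x), (v y).
  by rewrite !inE in xS yS; rewrite imsetU !imset_set1.
case=> x [y [xS yS axy ->]].
pose x' : induced U := Sub x (subsetP SU x xS).
pose y' : induced U := Sub y (subsetP SU y yS).
exists [set x'; y']; last by rewrite imsetU !imset_set1.
by apply/edgesP; exists x', y'; rewrite !inE.
Qed.

Lemma card_restrict (G : graph) (U S : {set G}) : S \subset U ->
  #|restrict U S| = #|S|.
Proof.
move=> SU; rewrite -(card_imset _ val_inj); congr #|pred_of_set _|.
apply/setP=> x; apply/imsetP/idP => [[x' + ->]|xS]; first by rewrite inE.
by exists (Sub x (subsetP SU x xS) : induced U); rewrite ?inE.
Qed.

Lemma restrict_imset (G : graph) (U : {set G}) (T : {set induced U}) :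
  restrict U [set val x | x in T] = T.
Proof. by apply/setP=> x; rewrite inE mem_imset //; apply: val_inj. Qed.

Lemma imset_val_sub (G : graph) (U S : {set G}) (T : {set induced U}) :
  T \subset restrict U S -> [set val x | x in T] \subset S.
Proof.
by move=> TS; apply/subsetP=> _ /imsetP[x /(subsetP TS) + ->]; rewrite inE.
Qed.

Lemma restrictU (G : graph) (U S T : {set G}) :
  restrict U (S :|: T) = restrict U S :|: restrict U T.
Proof. by apply/setP=> x; rewrite !inE. Qed.

Lemma restrictI (G : graph) (U S T : {set G}) :
  restrict U (S :&: T) = restrict U S :&: restrict U T.
Proof. by apply/setP=> x; rewrite !inE. Qed.

Lemma restrict_sub (G : graph) (U S T : {set G}) : S \subset U ->
  (restrict U S \subset restrict U T) = (S \subset T).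
Proof.
move=> SU; apply/subsetP/subsetP => [ST x xS|ST x]; last first.
  by rewrite !inE; apply: ST.
by have := ST (Sub x (subsetP SU x xS) : induced U); rewrite !inE; apply.
Qed.

Lemma restrict_proper (G : graph) (U S T : {set G}) :
  S \subset U -> T \subset U ->
  (restrict U S \proper restrict U T) = (S \proper T).
Proof. by move=> SU TU; rewrite !properE !restrict_sub. Qed.

Lemma card_induced (G : graph) (S : {set G}) : #|induced S| = #|S|.
Proof. by rewrite card_sig; apply: eq_card. Qed.

(** The isomorphism equates the sizes of the two unions; both [B] and [X] are disjoint from [A], so
    the size of [A] cancels. *)
Lemma card_copy (G : graph) (A B X : {set G}) : [disjoint A & B] ->
  copy_over A B X -> #|X| = #|B|.
Proof.
move=> dAB [dAX [e [[e_bij _] _]]].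
have := bij_eq_card e_bij.
rewrite !card_induced !cardsU (disjoint_setI0 dAB) (disjoint_setI0 dAX) cards0.
by rewrite !subn0 => /addnI ->.
Qed.

(** Each member contributes at least one element of its own to the union, which lies in [D]. *)
Lemma card_trivIset_le (T : finType) (F : {set {set T}}) (D : {set T}) :
  trivIset F -> (forall X, X \in F -> X != set0 /\ X \subset D) ->
  (#|F| <= #|D|)%N.
Proof.
move=> /eqP tF FD; apply: (@leq_trans #|cover F|).
  rewrite -tF -sum1_card; apply: leq_sum => X /FD[X0 _].
  by rewrite card_gt0.
by apply/subset_leq_card/bigcupsP => X /FD[].
Qed.

(** * Low degrees and proper colourings *)

Section Alpha.
Variables (R : realType) (alpha : R).

(** If all degrees inside [S] were at least $k$, then $k|S| \leq 2|E(S)| \leq 2\alpha|S|$, contrary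
    to $2\alpha < k$. *)
Lemma Kplus_low_degree (G : graph) (S : {set G}) (k : nat) :
  Kplus alpha G -> 2 * alpha < k%:R -> S != set0 ->
  exists2 x, x \in S & (#|[set y in S | adj x y]| < k)%N.
Proof.
move=> KG ak S0; apply/exists_inP; apply: contraT => /exists_inPn deg_ge.
have: (\sum_(x in S) k <= 2 * #|edges S|)%N.
  apply: leq_trans (sum_degree_edges S); apply: leq_sum => x xS.
  by rewrite leqNgt deg_ge.
rewrite sum_nat_const -(ler_nat R) !natrM leNgt => /negP[].
have S_gt0 : 0 < #|S|%:R :> R by rewrite ltr0n card_gt0.
have := KG S; rewrite /delta subr_ge0 => eS.
apply: (@le_lt_trans _ _ (2%:R * (alpha * #|S|%:R))).
  by rewrite ler_pM2l ?ltr0n.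
by rewrite mulrA [ltRHS]mulrC ltr_pM2r.
Qed.

(** Greedy colouring: remove a vertex of low degree, colour the rest by induction, and put the
    vertex back with a colour that its neighbours miss. *)
Lemma Kplus_colouring (G : graph) (k : nat) :
  Kplus alpha G -> 2 * alpha < k.+1%:R ->
  exists c : G -> 'I_k.+1, forall x y, adj x y -> c x != c y.
Proof.
move=> KG ak.
suff colour n (S : {set G}) : (#|S| <= n)%N ->
    exists c : G -> 'I_k.+1,
      {in S &, forall x y, adj x y -> c x != c y}.
  have [c cP] := colour _ [set: G] (leqnn _).
  by exists c => x y; apply: cP; rewrite inE.
elim: n S => [|n IHn] S Sn.
  exists (fun=> ord0) => x y xS; move: Sn.
  by rewrite leqn0 cards_eq0 => /eqP S0; rewrite S0 inE in xS.
have [->|S0] := eqVneq S set0.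
  by exists (fun=> ord0) => x y; rewrite inE.
have [x xS degx] := Kplus_low_degree KG ak S0.
have [|c cP] := IHn (S :\ x).
  by move: Sn; rewrite (cardsD1 x S) xS.
pose N := [set c y | y in [set y in S | adj x y]].
(* Pigeonhole: [x] has at most [k] neighbours in [S], and there are [k.+1] colours. *)
have [i iN] : exists i, i \notin N.
  apply/existsP; apply: contraLR degx => /existsPn Nfull; rewrite -leqNgt.
  apply: leq_trans (leq_imset_card c _); rewrite -[leqLHS]card_ord.
  by apply/subset_leq_card/subsetP => i _; apply: negbNE.
have fresh z : z \in S -> adj x z -> i != c z.
  move=> zS axz; apply: contraNneq iN => ->; apply: imset_f.
  by rewrite inE zS.
exists (fun y => if y == x then i else c y) => y z yS zS ayz.
have [yx|nyx] := eqVneq y x; have [zx|nzx] := eqVneq z x.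
- by rewrite yx zx adj_irr in ayz.
- by apply: fresh; rewrite // -yx.
- by rewrite eq_sym; apply: fresh; rewrite // -zx adj_sym.
- by apply: cP; rewrite // !inE ?nyx ?nzx.
Qed.

(** The criterion used for all three classes: the ends of one edge give two strong embeddings of the
    point, and a proper colouring tells their images apart. *)
Lemma not_one_point_ramsey_of_edge (K : graph -> Prop) (sub : strong_rel)
    (B : graph) (x y : B) :
  (forall G, K G -> Kplus alpha G) -> K B -> K (induced [set x]) ->
  adj x y -> sub B [set x] -> sub B [set y] -> ~ one_point_ramsey K sub.
Proof.
move=> KKplus KB KA axy sx sy ramsey; pose A := induced [set x].
have cardA : #|A| = 1%N by rewrite card_induced cards1.
pose a : A := Sub x (set11 x).
have A1 (u : A) : u = a.
  by apply/val_inj/eqP; have := valP u; rewrite inE.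
pose pt (z : B) : {ffun A -> B} := [ffun=> z].
have pt_strong z : sub B [set z] -> strong_embedding sub (pt z).
  move=> sz; split; first split => [u v _|u v].
  - by rewrite (A1 u) (A1 v).
  - by rewrite !ffunE (A1 u) (A1 v) !adj_irr.
  have -> // : [set pt z u | u : A] = [set z].
  apply/setP=> w; rewrite inE; apply/imsetP/eqP => [[u _ ->]|->].
    by rewrite ffunE.
  by exists a; rewrite ?ffunE.
(* The extra successor makes [k.+1] at least 2 by computation; [k] depends only on [alpha], so the
   number of colours is fixed before [C] is given. *)
pose k := (Num.bound `|2 * alpha|).+1.
have ak : 2 * alpha < k.+1%:R.
  apply: le_lt_trans (ler_norm _) _; apply: lt_le_trans (archi_boundP _) _ => //.
  by rewrite ler_nat /k; apply/leqW/leqnSn.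
have [|C [KC _ CB]] := ramsey A KA cardA B KB _ k.+1 isT.
  by exists (pt x); apply: pt_strong.
have [c cP] := Kplus_colouring (KKplus C KC) ak.
(* An embedding of the point gets the colour of its image vertex. *)
have [l [[_ l_adj] _] mono] := CB (fun g => c (g a)).
have := mono _ _ (pt_strong x sx) (pt_strong y sy).
by rewrite !ffunE; apply/eqP/cP; rewrite l_adj.
Qed.

(** * Predimension and 0-algebraic pairs in induced subgraphs *)

Lemma delta_restrict (G : graph) (U S : {set G}) : S \subset U ->
  delta alpha (restrict U S) = delta alpha S.
Proof. by move=> SU; rewrite /delta edges_restrict // card_restrict. Qed.

Lemma zero_algebraic_restrict (G : graph) (U A B : {set G}) :
  A \subset U -> B \subset U ->
  zero_algebraic alpha (restrict U A) (restrict U B) <->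
  zero_algebraic alpha A B.
Proof.
move=> AU BU.
have UE (T : {set G}) : T \subset U -> A :|: T \subset U.
  by move=> TU; rewrite subUset AU.
have dE : [disjoint restrict U A & restrict U B] = [disjoint A & B].
  rewrite -!setI_eq0 -restrictI -!cards_eq0 card_restrict //.
  by rewrite subIset ?AU.
rewrite /zero_algebraic /delta_over -restrictU dE.
rewrite !delta_restrict ?UE //; split=> [] [dAB AB0 pos]; split=> // B0.
  move=> B0n0 B0B.
  have B0U : B0 \subset U := subset_trans (proper_sub B0B) BU.
  have := pos (restrict U B0); rewrite -restrictU !delta_restrict ?UE //.
  apply; last by rewrite restrict_proper.
  by rewrite -cards_eq0 card_restrict // cards_eq0.
(* Every vertex set of the induced subgraph is the restriction of its image in [G], so the condition
   can be tested on that image. *)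
rewrite -(restrict_imset B0); set B1 := imset _ _ => B0n0 B0B.
have B1B : B1 \subset B.
  by apply: imset_val_sub; rewrite -(restrict_imset B0) proper_sub.
have B1U : B1 \subset U := subset_trans B1B BU.
rewrite -restrictU !delta_restrict ?UE //; apply: pos.
  by rewrite -card_gt0 -(card_restrict B1U) card_gt0.
by rewrite restrict_proper in B0B.
Qed.

(** Needed because the lower bound on [mu] is available only for pairs in [calE]. *)
Lemma calE_pair_of (G : graph) (A B : {set G}) :
  Kplus alpha G -> A != set0 -> zero_min_algebraic alpha A B ->
  calE alpha (pair_of A B).
Proof.
move=> KG A0 [AB minA]; set U := A :|: B.
have [AU BU] : A \subset U /\ B \subset U by rewrite subsetUl subsetUr.
have [dAB _ _] := AB.
have compA : ~: restrict U A = restrict U B.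
  apply/setP=> x; rewrite !inE; have := valP x; rewrite inE.
  have [xA|_ /= ->//] := boolP (val x \in A).
  by rewrite (disjointFr dAB xA).
split=> /=.
- move=> S; rewrite -(restrict_imset S) delta_restrict ?KG //.
  by apply: imset_val_sub; apply/subsetP=> x _; rewrite inE (valP x).
- by rewrite -cards_eq0 card_restrict // cards_eq0.
rewrite compA; split; first exact/zero_algebraic_restrict.
move=> A0'; rewrite -(restrict_imset A0'); set A1 := imset _ _ => A1A.
have A1U : A1 \subset U.
  apply: (subset_trans (imset_val_sub _) AU).
  by rewrite -(restrict_imset A0') proper_sub.
rewrite restrict_proper // in A1A.
by move/(zero_algebraic_restrict A1U BU); apply: minA.
Qed.

(** * Graphs with at most two vertices *)

Lemma delta_set1 (G : graph) (x : G) : delta alpha [set x] = alpha.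
Proof.
have -> : delta alpha [set x] = alpha - #|edges [set x]|%:R.
  by rewrite /delta cards1 mulr1.
suff -> : edges [set x] = set0 by rewrite cards0 subr0.
apply/setP=> e; rewrite [RHS]inE; apply/negP => ex.
by have := subset_leq_card (edge_sub ex); rewrite (card_edge ex) cards1.
Qed.

(** At most one edge is subtracted. The bound is split as the value at a point plus the increment
    $\alpha - 1$, whose sign decides whether points are strong. *)
Lemma delta_card2_ge (G : graph) (S : {set G}) :
  #|G| = 2%N -> #|S| = 2%N -> alpha + (alpha - 1) <= delta alpha S.
Proof.
move=> G2 S2; rewrite /delta S2 mulr_natr mulr2n -addrA lerD2l lerD2l lerN2.
by rewrite -[1]/(1%:R) ler_nat (leq_trans (card_edges_le2 _ _)) ?G2 ?leq_b1.
Qed.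

Lemma proper_set1_card2 (G : graph) (x : G) (S : {set G}) :
  #|G| = 2%N -> [set x] \proper S -> #|S| = 2%N.
Proof.
move=> G2 /proper_card; rewrite cards1 => S2; apply/eqP.
by rewrite eqn_leq S2 andbT -G2 max_card.
Qed.

Lemma lt_alpha_set1 (G : graph) (x : G) :
  1 < alpha -> #|G| = 2%N -> lt_alpha alpha [set x].
Proof.
move=> a1 G2 S /(proper_set1_card2 G2) /(delta_card2_ge G2).
by apply: lt_le_trans; rewrite delta_set1 ltrDl subr_gt0.
Qed.

Lemma le_alpha_set1 (G : graph) (x : G) :
  1 <= alpha -> #|G| = 2%N -> le_alpha alpha [set x].
Proof.
move=> a1 G2 S xS; rewrite /delta_over subr_ge0.
have [->//|nxS] := eqVneq [set x] S.
have := proper_set1_card2 G2; move/(_ x S); rewrite properEneq nxS xS.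
move=> /(_ isT) /(delta_card2_ge G2); apply: le_trans.
by rewrite delta_set1 lerDl subr_ge0.
Qed.

Lemma Kplus_card_le2 (G : graph) :
  1 <= alpha -> (#|G| <= 2)%N -> Kplus alpha G.
Proof.
move=> a1 G2 S; rewrite /delta subr_ge0.
apply: (@le_trans _ _ #|S|%:R); last by rewrite ler_peMl ?ler0n.
rewrite ler_nat (leq_trans (card_edges_le2 S G2)) //.
by case: eqP => // ->.
Qed.

(* One vertex of the base leaves at most one vertex for the copies, and then
   mu is at least 1 on the pair. *)
Lemma Kmu_card_le2 (mu : gpair -> nat) (G : graph) :
  1 <= alpha -> mu_function alpha mu -> (#|G| <= 2)%N -> Kmu alpha mu G.
Proof.
move=> a1 [_ _ mu_ge] G2; have KG := Kplus_card_le2 a1 G2.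
split=> // A B A0 ABmin F tF Fcopy.
have [[dAB _ _] minA] := ABmin.
(* An empty [B] would be 0-algebraic over the empty set, against the minimality of the nonempty base
   [A]. *)
have B0 : B != set0.
  apply/eqP=> B0; apply: (minA set0); first by rewrite proper0.
  rewrite B0; split; rewrite ?setU0 /delta_over ?subrr //.
    by rewrite -setI_eq0 setI0.
  by move=> B1 B1n0 /proper_sub; rewrite subset0 (negPf B1n0).
have F_le : (#|F| <= #|~: A|)%N.
  apply: card_trivIset_le => // X /Fcopy XB; split.
    by rewrite -card_gt0 (card_copy dAB XB) card_gt0.
  by case: XB => dAX _; rewrite -disjoints_subset disjoint_sym.
apply: (leq_trans F_le).
have A_gt0 : (0 < #|A|)%N by rewrite card_gt0.
have B_le : (#|B| <= #|~: A|)%N.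
  by apply: subset_leq_card; rewrite -disjoints_subset disjoint_sym.
have B_gt0 : (0 < #|B|)%N by rewrite card_gt0.
have AC := cardsC A.
have A1 : #|A| = 1%N.
  by apply/eqP; rewrite eqn_leq A_gt0 andbT -(leq_add2r #|~: A|) AC
    (leq_trans G2) // ltnS (leq_trans B_gt0).
apply: (@leq_trans 1); first by rewrite -(leq_add2l #|A|) AC A1.
(* The base is a single point, so its predimension is $\alpha \geq 1$. *)
rewrite -(ler_nat R); apply: le_trans (mu_ge _ (calE_pair_of KG A0 ABmin)).
rewrite /= delta_restrict ?subsetUl //.
by have /eqP/cards1P[x ->] := A1; rewrite delta_set1.
Qed.

End Alpha.

(** * The single edge and the three classes *)

Definition edge_adj : rel bool := fun x y => x != y.

Lemma edge_adj_sym : symmetric edge_adj.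
Proof. by case=> [] []. Qed.

Lemma edge_adj_irr : irreflexive edge_adj.
Proof. by case. Qed.

Definition edge_graph : graph := Graph edge_adj_sym edge_adj_irr.

Theorem theorem2p23 (R : realType) (alpha : R) (alpha_ge1 : 1 <= alpha) :
  [/\ ~ one_point_ramsey (@Kplus R alpha) (@le_alpha R alpha),
      (exists q : rat, alpha = ratr q) ->
        forall mu : gpair -> nat, mu_function alpha mu ->
          ~ one_point_ramsey (@Kmu R alpha mu) (@le_alpha R alpha)
    & forall f : R -> R, increasing_unbounded f -> good alpha f ->
        1 < alpha ->
        (exists2 G : graph, Kf alpha f G & exists x y : G, adj x y) ->
          ~ one_point_ramsey (@Kf R alpha f) (@lt_alpha R alpha)].
Proof.
pose x : edge_graph := true; pose y : edge_graph := false.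
have card_edge_graph : #|edge_graph| = 2%N := card_bool.
have card_pt : (#|induced [set x]| <= 2)%N by rewrite card_induced cards1.
split.
- apply: (@not_one_point_ramsey_of_edge R alpha _ _ edge_graph x y) => //.
  + by apply: Kplus_card_le2; rewrite ?card_edge_graph.
  + exact: Kplus_card_le2.
  + exact: le_alpha_set1.
  + exact: le_alpha_set1.
- move=> _ mu mu_fun.
  apply: (@not_one_point_ramsey_of_edge R alpha _ _ edge_graph x y) => //.
  + by move=> G [].
  + by apply: Kmu_card_le2; rewrite ?card_edge_graph.
  + exact: Kmu_card_le2.
  + exact: le_alpha_set1.
  + exact: le_alpha_set1.
(* Here [f] decides whether an edge lies in the class, so the edge is cut out of the given member
   [G], and heredity keeps it and its points in the class. Its ends are strong for the strict
   relation because $2\alpha - 1 > \alpha$. *)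
move=> f _ [_ _ hered] alpha_gt1 [G KG [u [v auv]]].
pose B := induced [set u; v]; have KB : Kf alpha f B by apply: hered.
have B2 : #|B| = 2%N by rewrite card_induced cards2 (adj_neq auv).
pose u' : B := Sub u (set21 u v); pose v' : B := Sub v (set22 u v).
apply: (@not_one_point_ramsey_of_edge R alpha _ _ B u' v') => //.
- by move=> H [].
- exact: hered.
- exact: lt_alpha_set1.
- exact: lt_alpha_set1.
Qed.
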